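(* Let $A,B\in\mathbb{C}^{n\times n}$. If $A$ and $B$ commute, then there are invertible matrices $S,T\in\mathbb{C}^{n\times n}$ such that $$S(A+\lambda B)T=\mathrm{diag}\big(\underbrace{\mathcal{L}_0^T,\ldots,\mathcal{L}_0^T}_{n_0},\underbrace{\mathcal{L}_{\delta_1}^T,\ldots,\mathcal{L}_{\delta_1}^T}_{n_1},\ldots,\underbrace{\mathcal{L}_{\delta_k}^T,\ldots,\mathcal{L}_{\delta_k}^T}_{n_k},\underbrace{\mathcal{L}_0,\ldots,\mathcal{L}_0}_{m_0},\underbrace{\mathcal{L}_{\varepsilon_1},\ldots,\mathcal{L}_{\varepsilon_1}}_{m_1},\ldots,\underbrace{\mathcal{L}_{\varepsilon_l},\ldots,\mathcal{L}_{\varepsilon_l}}_{m_l},\mathcal{J}_{\gamma_1}^{\lambda_1},\ldots,\mathcal{J}_{\gamma_p}^{\lambda_p},\mathcal{N}_{\beta_1},\ldots,\mathcal{N}_{\beta_q}\big),$$ where $0<\delta_1<\delta_2<\ldots<\delta_k$ and $0<\varepsilon_1<\varepsilon_2<\ldots<\varepsilon_l$ are integers, and $$\delta_in_i\leq n_0+n_1+\dots+n_{i-1}\quad\text{for } i=1,\dots,k,$$ $$\varepsilon_im_i\leq m_0+m_1+\dots+m_{i-1}\quad\text{for } i=1,\dots,l.$$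
   Context: The blocks are as in the Kronecker canonical form. $\mathcal{L}_t$ is the $t\times(t+1)$ pencil $[\,0\ \ I_t\,]+\lambda[\,I_t\ \ 0\,]$, i.e. with $\lambda$ at positions $(s,s)$, $1$ at positions $(s,s+1)$ and zeros elsewhere; $\mathcal{L}_t^T$ is its transpose, of size $(t+1)\times t$. In particular $\mathcal{L}_0$ is a degenerate block of size $0\times1$ (contributing a zero column) and $\mathcal{L}_0^T$ is a degenerate block of size $1\times0$ (contributing a zero row). $\mathcal{J}_\gamma^{\mu}$ is the $\gamma\times\gamma$ pencil $J+\lambda I_\gamma$, where $J$ is the Jordan block with $\mu\in\mathbb{C}$ on the diagonal and $1$ on the first superdiagonal. $\mathcal{N}_\beta$ is the $\beta\times\beta$ pencil $I_\beta+\lambda N$, where $N$ has $1$ on the first superdiagonal and zeros elsewhere. The multiplicities $n_i,m_j$ indicate how many times each block appears; any of the families of blocks may be absent ($n_0,m_0,k,l,p,q$ may be $0$). *)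

(* Defs.v *)
From HB Require Import structures.
From mathcomp Require Import all_boot all_order all_algebra.

Set Implicit Arguments.
Unset Strict Implicit.
Unset Printing Implicit Defensive.

Import GRing.Theory.
Local Open Scope ring_scope.

(* The pencil A + lambda B, with lambda the polynomial indeterminate. *)
Definition pencil (F : nzRingType) (m n : nat) (A B : 'M[F]_(m, n)) :
  'M[{poly F}]_(m, n) := map_mx polyC A + 'X *: map_mx polyC B.

Definition superdiag_mx (F : nzRingType) (m n : nat) : 'M[F]_(m, n) :=
  \matrix_(i < m, j < n) ((j == i.+1 :> nat)%:R).

(* For t = 0 this has size 0 x 1: as a diagonal block it adds a zero column,
   and its transpose adds a zero row. *)
Definition Lpencil (F : nzRingType) (t : nat) : 'M[{poly F}]_(t, t.+1) :=
  pencil (superdiag_mx F t t.+1) (pid_mx t).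

Definition Jpencil (F : nzRingType) (g : nat) (mu : F) : 'M[{poly F}]_g :=
  pencil (mu%:M + superdiag_mx F g g) 1%:M.

Definition Npencil (F : nzRingType) (b : nat) : 'M[{poly F}]_b :=
  pencil 1%:M (superdiag_mx F b b).

Inductive kblock (F : Type) : Type :=
  | BlockLT of nat
  | BlockL of nat
  | BlockJ of nat & F
  | BlockN of nat.

Arguments BlockLT {F} t.
Arguments BlockL {F} t.
Arguments BlockJ {F} g mu.
Arguments BlockN {F} b.

Definition block_rows (F : Type) (b : kblock F) : nat :=
  match b with
  | BlockLT t => t.+1
  | BlockL t => t
  | BlockJ g _ => g
  | BlockN b => b
  end.

Definition block_cols (F : Type) (b : kblock F) : nat :=
  match b with
  | BlockLT t => t
  | BlockL t => t.+1
  | BlockJ g _ => g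
  | BlockN b => b
  end.

Definition block_pencil (F : nzRingType) (b : kblock F) :
    'M[{poly F}]_(block_rows b, block_cols b) :=
  match b with
  | BlockLT t => (Lpencil F t)^T
  | BlockL t => Lpencil F t
  | BlockJ g mu => Jpencil g mu
  | BlockN b => Npencil F b
  end.

Fixpoint diag_rows (F : Type) (s : seq (kblock F)) : nat :=
  if s is b :: s' then (block_rows b + diag_rows s')%N else 0%N.

Fixpoint diag_cols (F : Type) (s : seq (kblock F)) : nat :=
  if s is b :: s' then (block_cols b + diag_cols s')%N else 0%N.

(* Block diagonal matrix with rectangular blocks; the library's \mxdiag only
   handles square ones. *)
Fixpoint diag_pencil (F : nzRingType) (s : seq (kblock F)) :
    'M[{poly F}]_(diag_rows s, diag_cols s) :=
  match s with
  | [::] => 0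
  | b :: s' => block_mx (block_pencil b) 0 0 (diag_pencil s')
  end.

(* Families are indexed from 1, so that nn 0 and mm 0 are the multiplicities
   of L_0^T and L_0; values of the functions at other indices are ignored. *)
Definition kronecker_blocks (F : Type)
    (k : nat) (nn delta : nat -> nat) (l : nat) (mm eps : nat -> nat)
    (p : nat) (gamma : nat -> nat) (lam : nat -> F)
    (q : nat) (beta : nat -> nat) : seq (kblock F) :=
  nseq (nn 0%N) (BlockLT 0)
  ++ flatten [seq nseq (nn i) (BlockLT (delta i)) | i <- iota 1 k]
  ++ nseq (mm 0%N) (BlockL 0)
  ++ flatten [seq nseq (mm i) (BlockL (eps i)) | i <- iota 1 l]
  ++ [seq BlockJ (gamma i) (lam i) | i <- iota 1 p]
  ++ [seq BlockN (beta i) | i <- iota 1 q].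

(* Main.v *)
Require Import Defs.
From HB Require Import structures.
From mathcomp Require Import all_boot all_order all_algebra.
From mathcomp Require Import reals complex.
From mathcomp Require Import fingroup perm zify.
From Stdlib Require Import Setoid Morphisms.

Import GRing.Theory.
Local Open Scope ring_scope.
Local Open Scope complex_scope.

Set Implicit Arguments.
Unset Strict Implicit.
Unset Printing Implicit Defensive.

(* Kronecker form: if B is not onto, (A, B) restricts to the smaller pencil
   A^-1(im B) -> im B; a complement of A^-1(im B) supplies one new basis vector for
   each block of the restriction on which B is not onto, lengthening that block by
   one, and otherwise contributes only blocks N_1 and L_0^T. If B is not injective,
   transpose; if B is bijective, apply the same step to (1, B^-1 A - mu) for an
   eigenvalue mu.

   Inequalities: if A = S^-1 D_A T^-1 and B = S^-1 D_B T^-1 commute, the invertible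
   matrix P = (S T)^-1 satisfies D_A P D_B = D_B P D_A. On the rows of a block L_e
   this says that the coefficients form a singular chain of degree e - 1, so P maps
   them into the columns of the blocks L_e' with e' < e. Comparing ranks,
   \sum_(e <= d) e <= \sum_(e < d) (e + 1) over the indices of the L blocks, which at
   d = eps_i is the claimed inequality. The L^T blocks follow by transposing A, B. *)

(** * Strict equivalence of pencils *)

Definition mxinv (F : fieldType) (m n : nat) (S : 'M[F]_(m, n))
  (S' : 'M[F]_(n, m)) : Prop := S *m S' = 1%:M /\ S' *m S = 1%:M.

Lemma mxinv1 (F : fieldType) (n : nat) : mxinv (1%:M : 'M[F]_n) 1%:M.
Proof. by split; rewrite mulmx1. Qed.

Lemma mxinv_sym (F : fieldType) (m n : nat) (S : 'M[F]_(m, n)) S' :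
  mxinv S S' -> mxinv S' S.
Proof. by case. Qed.

Lemma mxinv_tr (F : fieldType) (m n : nat) (S : 'M[F]_(m, n)) S' :
  mxinv S S' -> mxinv S^T S'^T.
Proof. by case=> h h'; split; rewrite -trmx_mul ?h ?h' trmx1. Qed.

Lemma mxinv_mul (F : fieldType) (m n p : nat) (S : 'M[F]_(m, n)) S'
  (T : 'M[F]_(n, p)) T' :
  mxinv S S' -> mxinv T T' -> mxinv (S *m T) (T' *m S').
Proof.
move=> [h1 h2] [h3 h4]; split.
  by rewrite mulmxA -(mulmxA S) h3 mulmx1.
by rewrite mulmxA -(mulmxA T') h2 mulmx1.
Qed.

Lemma mxinv_diag (F : fieldType) (m n m' n' : nat) (S : 'M[F]_(m, n)) S'
  (T : 'M[F]_(m', n')) T' :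
  mxinv S S' -> mxinv T T' -> mxinv (block_mx S 0 0 T) (block_mx S' 0 0 T').
Proof.
move=> [h1 h2] [h3 h4]; split; rewrite mulmx_block !mulmx0 !mul0mx !addr0 add0r.
  by rewrite h1 h3 -scalar_mx_block.
by rewrite h2 h4 -scalar_mx_block.
Qed.

Lemma mxinv_unip (F : fieldType) (m n : nat) (X : 'M[F]_(m, n)) :
  mxinv (block_mx 1%:M X 0 1%:M) (block_mx 1%:M (- X) 0 1%:M).
Proof.
split; rewrite mulmx_block !mulmx0 !mul0mx !mul1mx !mulmx1 !addr0 add0r.
  by rewrite addNr -scalar_mx_block.
by rewrite addrN -scalar_mx_block.
Qed.

Lemma mxinv_swap (F : fieldType) (m n : nat) :
  mxinv (block_mx 0 1%:M 1%:M 0 : 'M[F]_(m + n, n + m)) (block_mx 0 1%:M 1%:M 0).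
Proof.
split; rewrite mulmx_block !mulmx0 !mul0mx !mul1mx ?addr0 ?add0r.
  by rewrite -scalar_mx_block.
by rewrite -scalar_mx_block.
Qed.

Lemma mxinv_dim (F : fieldType) (m n : nat) (S : 'M[F]_(m, n)) S' :
  mxinv S S' -> m = n.
Proof.
by case=> /mulmx1_min h /mulmx1_min h'; apply/eqP; rewrite eqn_leq h h'.
Qed.

Lemma mxrank_inv (F : fieldType) (m n m' n' : nat) (S : 'M[F]_(m, m'))
  S' (T : 'M[F]_(n', n)) T' (A : 'M[F]_(m', n')) :
  mxinv S S' -> mxinv T T' -> \rank (S *m A *m T) = \rank A.
Proof.
move=> [_ h] [h' _]; rewrite mxrankMfree; last by apply/row_freeP; exists T'.
rewrite -mxrank_tr trmx_mul mxrankMfree ?mxrank_tr //.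
by apply/row_freeP; exists S'^T; rewrite -trmx_mul h trmx1.
Qed.

(** [U] consists of [R] followed by a basis of the kernel of [C]: every vector splits between the
    two, because [1 - R C] maps into the kernel. *)
Lemma right_inv_complete (F : fieldType) (c s : nat) (C : 'M[F]_(c, s))
  (R : 'M[F]_(s, c)) :
  C *m R = 1%:M ->
  exists (a : nat) (U : 'M[F]_(s, c + a)) (U' : 'M[F]_(c + a, s)),
    mxinv U U' /\ C *m U = row_mx 1%:M 0.
Proof.
move=> CR; set K := row_base (kermx C^T).
have CK : C *m K^T = 0.
  apply: trmx_inj; rewrite trmx_mul trmxK trmx0.
  by apply/sub_kermxP; rewrite eq_row_base.
have [L KL] : exists L, K *m L = 1%:M by apply/row_freeP/row_base_free.
have LK : L^T *m K^T = 1%:M by rewrite -trmx_mul KL trmx1.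
have : ((1%:M - R *m C)^T <= K)%MS.
  rewrite eq_row_base; apply/sub_kermxP.
  by rewrite -trmx_mul mulmxBr mulmx1 mulmxA CR mul1mx subrr trmx0.
case/submxP => X0 /(congr1 trmx); rewrite trmxK trmx_mul; set X := X0^T => eX.
have eqX : X = L^T *m (1%:M - R *m C) by rewrite eX mulmxA LK mul1mx.
exists _, (row_mx R K^T), (col_mx C X); split; last by rewrite mul_mx_row CR CK.
split; first by rewrite mul_row_col -eX addrC subrK.
rewrite mul_col_row CR CK eqX -!mulmxA !mulmxBl !mul1mx -!mulmxA CR CK mulmx1.
by rewrite subrr !mulmx0 subr0 LK -scalar_mx_block.
Qed.

Lemma left_inv_complete (F : fieldType) (c s : nat) (C : 'M[F]_(s, c))
  (L : 'M[F]_(c, s)) :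
  L *m C = 1%:M ->
  exists (a : nat) (U : 'M[F]_(c + a, s)) (U' : 'M[F]_(s, c + a)),
    mxinv U U' /\ U *m C = col_mx 1%:M 0.
Proof.
move=> /(congr1 trmx); rewrite trmx_mul trmx1 => /right_inv_complete.
case=> a [U [U' [/mxinv_tr i e]]]; exists a, U^T, U'^T; split=> //.
by apply: trmx_inj; rewrite trmx_mul trmxK e tr_col_mx trmx1 trmx0.
Qed.

Record pen (F : fieldType) := Pen
  { prows : nat; pcols : nat;
    penA : 'M[F]_(prows, pcols); penB : 'M[F]_(prows, pcols) }.

(* [S], [T] are rectangular in form only: this avoids casts between provably
   equal dimensions. *)
Definition peq (F : fieldType) (p q : pen F) : Prop :=
  exists (S : 'M[F]_(prows q, prows p)) (S' : 'M[F]_(prows p, prows q))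
         (T : 'M[F]_(pcols p, pcols q)) (T' : 'M[F]_(pcols q, pcols p)),
  [/\ mxinv S S', mxinv T T', S *m penA p *m T = penA q &
      S *m penB p *m T = penB q].

Notation "p ~= q" := (peq p q) (at level 70).

Lemma peq_refl (F : fieldType) (p : pen F) : p ~= p.
Proof.
by exists 1%:M, 1%:M, 1%:M, 1%:M; split; rewrite ?mul1mx ?mulmx1 //; apply: mxinv1.
Qed.

Lemma peq_sym (F : fieldType) (p q : pen F) : p ~= q -> q ~= p.
Proof.
case=> S [S' [T [T' [iS iT eA eB]]]]; exists S', S, T', T.
case: (iS) (iT) => [_ s] [t _]; split; try exact: mxinv_sym.
  by rewrite -eA !mulmxA s mul1mx -mulmxA t mulmx1.
by rewrite -eB !mulmxA s mul1mx -mulmxA t mulmx1.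
Qed.

Lemma peq_trans (F : fieldType) (p q r : pen F) : p ~= q -> q ~= r -> p ~= r.
Proof.
case=> S [S' [T [T' [iS iT eA eB]]]] [S1 [S1' [T1 [T1' [iS1 iT1 eA1 eB1]]]]].
exists (S1 *m S), (S' *m S1'), (T *m T1), (T1' *m T').
split; try exact: mxinv_mul.
  by rewrite -eA1 -eA !mulmxA.
by rewrite -eB1 -eB !mulmxA.
Qed.

#[export] Instance peq_equiv (F : fieldType) : Equivalence (@peq F).
Proof. split; [exact: peq_refl|exact: peq_sym|exact: peq_trans]. Qed.

Lemma peq_l (F : fieldType) (m m' n : nat) (S : 'M[F]_(m', m)) S'
  (A B : 'M[F]_(m, n)) : mxinv S S' -> Pen A B ~= Pen (S *m A) (S *m B).
Proof.
move=> i; exists S, S', 1%:M, 1%:M.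
by split; rewrite ?mulmx1 //; apply: mxinv1.
Qed.

Lemma peq_r (F : fieldType) (m n n' : nat) (T : 'M[F]_(n, n')) T'
  (A B : 'M[F]_(m, n)) : mxinv T T' -> Pen A B ~= Pen (A *m T) (B *m T).
Proof.
move=> i; exists 1%:M, 1%:M, T, T'.
by split; rewrite ?mul1mx //; apply: mxinv1.
Qed.

Lemma peq_cast (F : fieldType) (m n m' n' : nat) (e : (m = m') * (n = n'))
  (A B : 'M[F]_(m, n)) : Pen A B ~= Pen (castmx e A) (castmx e B).
Proof.
case: e => em en; case: m' / em; case: n' / en; rewrite !castmx_id.
reflexivity.
Qed.

(** Sizes are often equal only propositionally; comparing entries at equal numerical positions
    replaces casts. *)
Lemma peq_val (F : fieldType) (m n m' n' : nat)
  (A B : 'M[F]_(m, n)) (A' B' : 'M[F]_(m', n')) :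
  m = m' -> n = n' ->
  (forall (i : 'I_m) (j : 'I_n) (i' : 'I_m') (j' : 'I_n'),
     i = i' :> nat -> j = j' :> nat -> A i j = A' i' j') ->
  (forall (i : 'I_m) (j : 'I_n) (i' : 'I_m') (j' : 'I_n'),
     i = i' :> nat -> j = j' :> nat -> B i j = B' i' j') ->
  Pen A B ~= Pen A' B'.
Proof.
move=> em en; case: m' / em A' B'; case: n' / en => A' B' eA eB.
have -> : A = A' by apply/matrixP => i j; apply: eA.
have -> : B = B' by apply/matrixP => i j; apply: eB.
reflexivity.
Qed.

Definition psum (F : fieldType) (p q : pen F) : pen F :=
  Pen (block_mx (penA p) 0 0 (penA q)) (block_mx (penB p) 0 0 (penB q)).

Definition pen0 (F : fieldType) : pen F := Pen (0 : 'M_(0, 0)) 0.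

#[export] Instance psum_proper (F : fieldType) :
  Proper (@peq F ==> @peq F ==> @peq F) (@psum F).
Proof.
move=> p p' [S [S' [T [T' [iS iT eA eB]]]]] q q' [S1 [S1' [T1 [T1' [iS1 iT1 eA1 eB1]]]]].
exists (block_mx S 0 0 S1), (block_mx S' 0 0 S1').
exists (block_mx T 0 0 T1), (block_mx T' 0 0 T1').
split; try exact: mxinv_diag.
  by rewrite /= !mulmx_block !mulmx0 !mul0mx !addr0 !add0r ?mul0mx eA eA1.
by rewrite /= !mulmx_block !mulmx0 !mul0mx !addr0 !add0r ?mul0mx eB eB1.
Qed.

Lemma psumC (F : fieldType) (p q : pen F) : psum p q ~= psum q p.
Proof.
exists (block_mx 0 1%:M 1%:M 0), (block_mx 0 1%:M 1%:M 0).
exists (block_mx 0 1%:M 1%:M 0), (block_mx 0 1%:M 1%:M 0).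
split; try exact: mxinv_swap.
  by rewrite /= !mulmx_block !mulmx0 !mul0mx !addr0 !add0r !mul1mx !mulmx1 ?mul0mx.
by rewrite /= !mulmx_block !mulmx0 !mul0mx !addr0 !add0r !mul1mx !mulmx1 ?mul0mx.
Qed.

Lemma psumA (F : fieldType) (p q r : pen F) :
  psum p (psum q r) ~= psum (psum p q) r.
Proof.
case: p q r => [m1 n1 A1 B1] [m2 n2 A2 B2] [m3 n3 A3 B3]; rewrite /psum /=.
rewrite [X in Pen _ _ ~= X](peq_cast (esym (addnA m1 m2 m3), esym (addnA n1 n2 n3))).
rewrite -!row_mx0 -!col_mx0 -!block_mxA !row_mx0 !col_mx0.
reflexivity.
Qed.

(** The [z] by 0 pencil is a sum of [z] blocks [L_0^T]; this is how the zero rows left by the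
    reduction enter the list of blocks. *)
Lemma psum_zero_rows (F : fieldType) (z m n : nat) (A B : 'M[F]_(m, n)) :
  psum (Pen A B) (Pen (0 : 'M_(z, 0)) 0) ~= Pen (col_mx A (0 : 'M_(z, n))) (col_mx B 0).
Proof.
symmetry; have i : mxinv (row_mx 1%:M 0 : 'M[F]_(n, n + 0)) (col_mx 1%:M 0).
  split; first by rewrite mul_row_col mulmx1 mulmx0 addr0.
  rewrite mul_col_row mulmx1 mulmx0 mul0mx scalar_mx_block.
  by rewrite [X in block_mx _ _ _ X]thinmx0 [in RHS](thinmx0 1%:M).
rewrite (peq_r _ _ i) /psum /= !mul_mx_row !mulmx1 !mulmx0.
by rewrite !block_mxEh !col_mx0; reflexivity.
Qed.

Lemma psum0 (F : fieldType) (p : pen F) : psum p (pen0 F) ~= p.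
Proof.
case: p => m n A B; rewrite /pen0 psum_zero_rows.
have i : mxinv (row_mx 1%:M 0 : 'M[F]_(m, m + 0)) (col_mx 1%:M 0).
  split; first by rewrite mul_row_col mulmx1 mulmx0 addr0.
  rewrite mul_col_row mulmx1 mulmx0 mul0mx scalar_mx_block.
  by rewrite [X in block_mx _ _ _ X]thinmx0 [in RHS](thinmx0 1%:M).
rewrite (peq_l _ _ i) !mul_row_col !mul1mx !mulmx0 !addr0; reflexivity.
Qed.

Lemma psum0l (F : fieldType) (p : pen F) : psum (pen0 F) p ~= p.
Proof. by rewrite psumC; apply: psum0. Qed.

Definition ptr (F : fieldType) (p : pen F) : pen F := Pen (penA p)^T (penB p)^T.

#[export] Instance ptr_proper (F : fieldType) : Proper (@peq F ==> @peq F) (@ptr F).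
Proof.
move=> p q [S [S' [T [T' [iS iT eA eB]]]]].
exists T^T, T'^T, S^T, S'^T; split; try exact: mxinv_tr.
  by rewrite /= -eA !trmx_mul mulmxA.
by rewrite /= -eB !trmx_mul mulmxA.
Qed.

Lemma ptrK (F : fieldType) (p : pen F) : ptr (ptr p) = p.
Proof. by case: p => m n A B; rewrite /ptr /= !trmxK. Qed.

Lemma ptr_psum (F : fieldType) (p q : pen F) : ptr (psum p q) = psum (ptr p) (ptr q).
Proof. by rewrite /ptr /psum /= !tr_block_mx !trmx0. Qed.

(* For bijective [penB p] the reduction below is run on this reparametrized pencil. *)
Definition psh (F : fieldType) (mu : F) (p : pen F) : pen F :=
  Pen (penB p) (penA p - mu *: penB p).

#[export] Instance psh_proper (F : fieldType) (mu : F) :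
  Proper (@peq F ==> @peq F) (@psh F mu).
Proof.
move=> p q [S [S' [T [T' [iS iT eA eB]]]]].
exists S, S', T, T'; split=> //=.
by rewrite mulmxBr mulmxBl eA -scalemxAr -scalemxAl eB.
Qed.

Lemma psh_inj (F : fieldType) (mu : F) (p q : pen F) :
  psh mu p ~= psh mu q -> p ~= q.
Proof.
case=> S [S' [T [T' [iS iT /= eB eA]]]]; exists S, S', T, T'; split=> //.
move: eA; rewrite mulmxBr mulmxBl -scalemxAr -scalemxAl eB.
by move/(congr1 (+%R^~ (mu *: penB q))); rewrite !subrK.
Qed.

Lemma psh_psum (F : fieldType) (mu : F) (p q : pen F) :
  psh mu (psum p q) = psum (psh mu p) (psh mu q).
Proof.
by rewrite /psh /psum /= scale_block_mx opp_block_mx add_block_mx !scaler0 !subr0.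
Qed.

(** * The reduction step *)

Lemma row_mx_col0 (F : fieldType) (m n p z : nat) (D : 'M[F]_(m, n)) :
  row_mx (0 : 'M_(m + z, p)) (col_mx D 0) = col_mx (row_mx 0 D) 0.
Proof. by rewrite -[0 in LHS]col_mx0 -block_mxEh block_mxEv row_mx0. Qed.

(** Comes from the rank factorization of [A]: completing a left inverse of [col_base A] compresses
    the rows. *)
Lemma row_reduce (F : fieldType) (m n : nat) (A : 'M[F]_(m, n)) :
  exists (z : nat) (S : 'M[F]_(\rank A + z, m)) (S' : 'M[F]_(m, \rank A + z))
         (H : 'M[F]_(\rank A, n)) (R : 'M[F]_(n, \rank A)),
  [/\ mxinv S S', S *m A = col_mx H 0 & H *m R = 1%:M].
Proof.
have [L LB] : exists L, L *m col_base A = 1%:M by apply/row_fullP/col_base_full.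
have [R BR] : exists R, row_base A *m R = 1%:M by apply/row_freeP/row_base_free.
have [z [S [S' [iS SB]]]] := left_inv_complete LB.
exists z, S, S', (row_base A), R; split=> //.
transitivity (S *m (col_base A *m row_base A)); first by rewrite mulmx_base.
by rewrite mulmxA SB mul_col_mx mul1mx mul0mx.
Qed.

(** The upper rows are coordinates on the image of [B]. The first [n1] columns span the preimage of
    that image under [A]; the other [s] span a complement, on which [A] is injective modulo the
    image, hence the identity block. [R] records that [B] is onto its image. *)
Lemma pencil_reduce (F : fieldType) (m n : nat) (A B : 'M[F]_(m, n)) :
  exists (n1 s z : nat) (A1 B1 : 'M[F]_(\rank B, n1)) (B12 : 'M[F]_(\rank B, s))
         (R : 'M[F]_(n1 + s, \rank B)),
    row_mx B1 B12 *m R = 1%:M /\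
    Pen A B ~= Pen (block_mx A1 0 0 (col_mx 1%:M (0 : 'M_(z, s))))
                   (block_mx B1 B12 0 0).
Proof.
have [z0 [S [S' [H [H' [iS SB BH']]]]]] := row_reduce B.
set A1 := usubmx (S *m A); set A2 := dsubmx (S *m A).
have SA : S *m A = col_mx A1 A2 by rewrite vsubmxK.
have [z [S2 [S2' [H2 [R2 [iS2 SA2 AR2]]]]]] := row_reduce A2.
have [n1 [T0 [T0' [iT0 AT0]]]] := right_inv_complete AR2.
(* [T0] puts the kernel of [H2], which is the preimage of the image of [B], in the last columns; the
   swap brings it to the front. *)
pose T := T0 *m block_mx 0 1%:M 1%:M 0.
have iT := mxinv_mul iT0 (mxinv_swap F _ _).
have AT : H2 *m T = row_mx 0 1%:M.
  by rewrite mulmxA AT0 mul_row_block !mul1mx !mul0mx ?mulmx0 !addr0.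
exists n1, (\rank A2), z, (lsubmx (A1 *m T)), (lsubmx (H *m T)).
exists (rsubmx (H *m T)), (block_mx 0 1%:M 1%:M 0 *m T0' *m H').
split.
  have [iTT' _] := iT.
  by rewrite hsubmxK mulmxA -(mulmxA _ T) iTT' mulmx1.
rewrite (peq_l _ _ iS) SA SB (peq_l _ _ (mxinv_diag (mxinv1 F _) iS2)).
rewrite !mul_block_col !mul1mx !mul0mx !mulmx0 !addr0 !add0r SA2.
rewrite (peq_r _ _ iT) !mul_col_mx -/T AT !mul0mx.
set a := A1 *m T; set b := H *m T.
rewrite -[a]hsubmxK -[b]hsubmxK; move: (lsubmx a) (rsubmx a) (lsubmx b) (rsubmx b).
move=> a1 a2 b1 b2.
(* Multiples of the identity rows clear [a2]; the second matrix does not change, being zero on those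
   rows. *)
rewrite (peq_l _ _ (mxinv_unip (row_mx (- a2) 0))).
rewrite !mul_block_col !mul_row_col !mul1mx !mul0mx !mulmx0 !addr0 !add0r.
rewrite mul_mx_row mulmx0 mulmx1 add_row_mx addr0 addrN.
rewrite !block_mxEv row_mx0 row_mx_col0 !row_mxKl !row_mxKr.
reflexivity.
Qed.

Lemma castmx_block_diag (F : fieldType) (m1 m2 m3 n1 n2 n3 : nat)
  (X1 : 'M[F]_(m1, n1)) (X2 : 'M_(m1, n2)) (X3 : 'M_(m2, n1)) (X4 : 'M_(m2, n2))
  (X5 : 'M_(m3, n3)) :
  castmx (esym (addnA m1 m2 m3), esym (addnA n1 n2 n3))
    (block_mx (block_mx X1 X2 X3 X4) 0 0 X5)
  = block_mx X1 (row_mx X2 0) (col_mx X3 0) (block_mx X4 0 0 X5).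
Proof. by rewrite block_mxA col_mx0 row_mx0. Qed.

(* [p] is extended by one basis vector for each element of a basis [E] of a
   complement of the image of [penB p], which is sent to [E] by the second matrix. *)
Definition extends (F : fieldType) (p q : pen F) : Prop :=
  exists (c : nat) (E : 'M[F]_(prows p, c)) (K : 'M[F]_(c, prows p))
         (Y : 'M[F]_(pcols p, prows p)),
  [/\ penB p *m Y + E *m K = 1%:M, K *m penB p = 0, K *m E = 1%:M &
      Pen (block_mx (penA p) 0 0 1%:M) (block_mx (penB p) E 0 0) ~= q].

(** Modulo the image of [B1], the columns of [B12] cover the complement spanned by [E]. So [c] of
    the [s] columns can be turned into [E], which yields [q], and the other [a] into zero columns of
    the second matrix, which are blocks [N_1]. *)
Lemma extends_reduced (F : fieldType) (r n1 s z : nat) (A1 B1 : 'M[F]_(r, n1))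
  (B12 : 'M[F]_(r, s)) (R : 'M[F]_(n1 + s, r)) (q : pen F) :
  row_mx B1 B12 *m R = 1%:M -> extends (Pen A1 B1) q ->
  exists a : nat,
    Pen (block_mx A1 0 0 (col_mx 1%:M (0 : 'M_(z, s)))) (block_mx B1 B12 0 0)
    ~= psum (psum q (Pen (1%:M : 'M_a) 0)) (Pen (0 : 'M_(z, 0)) 0).
Proof.
move=> hR [c [E [K [Y [/= BY KB KE eq]]]]].
have KBR : (K *m B12) *m (dsubmx R *m E) = 1%:M.
  rewrite -KE -[E in RHS]mul1mx -hR -[in RHS](vsubmxK R) mul_row_col.
  by rewrite mulmxDl mulmxDr -!mulmxA (mulmxA K B1) KB mul0mx add0r.
have [a [U [U' [iU CU]]]] := right_inv_complete KBR.
exists a; have [UU' U'U] := iU.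
have EKB : B12 - B1 *m (Y *m B12) = E *m K *m B12.
  by rewrite mulmxA -[X in X - _]mul1mx -BY mulmxDl addrC addKr.
(* Subtracting [B1 Y B12] leaves of [B12] its component [E K B12]. The same operation creates
   [- A1 Y B12] in the first matrix, which the next row operation cancels against the identity
   rows. *)
rewrite (peq_r _ _ (mxinv_unip (- (Y *m B12)))).
rewrite (peq_l _ _ (mxinv_unip (row_mx (A1 *m Y *m B12) (0 : 'M_(r, z))))).
rewrite !mulmx_block !mul1mx !mulmx1 !mul0mx !mulmx0 !addr0 !add0r.
rewrite !mul_row_col !mulmx1 mul0mx addr0 !mulmxN mulmxA addNr.
rewrite [- _ + B12]addrC EKB.
(* [U] brings [K B12] to [[1 0]], and its inverse on the rows restores the identity block of the
   first matrix. *)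
rewrite (peq_r _ _ (mxinv_diag (mxinv1 F n1) iU)).
rewrite (peq_l _ _ (mxinv_diag (mxinv1 F r)
                      (mxinv_diag (mxinv_sym iU) (mxinv1 F z)))).
rewrite !mulmx_block !mul1mx !mulmx1 !mul0mx !mulmx0 !addr0 !add0r.

rewrite !mulmx0 (mul_col_mx 1%:M) mul1mx mul0mx mul_block_col !mul0mx !mulmx0 !addr0.
rewrite U'U -!mulmxA (mulmxA K) CU mul_mx_row mulmx1 mulmx0.
rewrite -eq {2}/psum /=.
rewrite [X in psum X _](peq_cast (esym (addnA r c a), esym (addnA n1 c a))).
rewrite !castmx_block_diag psum_zero_rows /=.
rewrite [X in _ ~= X](peq_cast (esym (addnA r (c + a)%N z), erefl _)).
rewrite -scalar_mx_block !block_mxEv !col_mx0 !row_mx0 -!col_mxA.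
rewrite col_mx0 row_mx_col0 ?row_mx0 ?col_mx0.
reflexivity.
Qed.

Lemma extends_peq (F : fieldType) (p p' q : pen F) :
  p ~= p' -> extends p q -> extends p' q.
Proof.
case=> S [S' [T [T' [iS iT eA eB]]]] [c [E [K [Y [BY KB KE eq]]]]].
have [SS' S'S] := iS; have [TT' T'T] := iT.
exists c, (S *m E), (K *m S'), (T' *m Y *m S'); split.
- rewrite -eB !mulmxA -(mulmxA _ T) TT' mulmx1 -!mulmxA -mulmxDr.
  by rewrite !mulmxA -mulmxDl BY mul1mx SS'.
- by rewrite -eB !mulmxA -(mulmxA _ S') S'S mulmx1 KB mul0mx.
- by rewrite -mulmxA (mulmxA S') S'S mul1mx.
rewrite -eq [X in _ ~= X](peq_l _ _ (mxinv_diag iS (mxinv1 F c))).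
rewrite [X in _ ~= X](peq_r _ _ (mxinv_diag iT (mxinv1 F c))).
rewrite !mulmx_block !mul1mx !mulmx1 !mul0mx !mulmx0 !addr0 !add0r !mul0mx eA eB.
reflexivity.
Qed.

Lemma mxinv_mid_swap (F : fieldType) (a b c d : nat) :
  mxinv (block_mx (block_mx 1%:M 0 0 0) (block_mx 0 0 1%:M 0)
                  (block_mx 0 1%:M 0 0) (block_mx 0 0 0 1%:M)
           : 'M[F]_((a + b) + (c + d), (a + c) + (b + d)))
        (block_mx (block_mx 1%:M 0 0 0) (block_mx 0 0 1%:M 0)
                  (block_mx 0 1%:M 0 0) (block_mx 0 0 0 1%:M)).
Proof.
split; rewrite !mulmx_block !mul1mx ?mulmx1 !mul0mx ?mulmx0 !addr0 ?add0r.
  by rewrite !add_block_mx !addr0 !add0r !block_mx0 -!scalar_mx_block.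
by rewrite !add_block_mx !addr0 !add0r !block_mx0 -!scalar_mx_block.
Qed.

Lemma extends_psum (F : fieldType) (p q p' q' : pen F) :
  extends p q -> extends p' q' -> extends (psum p p') (psum q q').
Proof.
move=> [c [E [K [Y [BY KB KE eq]]]]] [c' [E' [K' [Y' [BY' KB' KE' eq']]]]].
exists (c + c')%N, (block_mx E 0 0 E'), (block_mx K 0 0 K'), (block_mx Y 0 0 Y').
rewrite /psum /=; split.
- rewrite !mulmx_block add_block_mx !mul0mx !mulmx0 !addr0 !add0r BY BY'.
  by rewrite -scalar_mx_block.
- by rewrite mulmx_block !mul0mx !mulmx0 !addr0 !add0r KB KB' block_mx0.
- by rewrite mulmx_block !mul0mx !mulmx0 !addr0 !add0r KE KE' -scalar_mx_block.
rewrite -/(psum q q') -eq -eq' (peq_l _ _ (mxinv_mid_swap F _ _ _ _)).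
rewrite (peq_r _ _ (mxinv_mid_swap F _ _ _ _)) /psum /=.
rewrite (scalar_mx_block c c').
rewrite !mulmx_block !mul0mx !mulmx0 !mul1mx ?mulmx1 !addr0 ?add0r.
rewrite ?add_block_mx ?mulmx_block ?add_block_mx ?mul0mx ?mulmx0 ?addr0 ?add0r.
rewrite !mulmx1 !block_mx0.
reflexivity.
Qed.

(** The image of an onto map has zero complement, so [c = 0] and no vector is added. *)
Lemma extends_refl (F : fieldType) (p : pen F) (Y : 'M[F]_(pcols p, prows p)) :
  penB p *m Y = 1%:M -> extends p p.
Proof.
move=> BY; exists 0%N, 0, 0, Y; split.
- by rewrite BY mul0mx addr0.
- by rewrite mul0mx.
- by rewrite [LHS]thinmx0 [RHS]thinmx0.
rewrite -[X in _ ~= X]psum0 /psum /pen0 /=.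
rewrite (thinmx0 1%:M); reflexivity.
Qed.

(** * Canonical blocks and their direct sums *)

Definition blockA (F : fieldType) (b : kblock F) : 'M[F]_(block_rows b, block_cols b) :=
  match b with
  | BlockLT t => (superdiag_mx F t t.+1)^T
  | BlockL t => superdiag_mx F t t.+1
  | BlockJ g mu => mu%:M + superdiag_mx F g g
  | BlockN b => 1%:M
  end.

Definition blockB (F : fieldType) (b : kblock F) : 'M[F]_(block_rows b, block_cols b) :=
  match b with
  | BlockLT t => (pid_mx t)^T
  | BlockL t => pid_mx t
  | BlockJ g mu => 1%:M
  | BlockN b => superdiag_mx F b b
  end.

Definition bpen (F : fieldType) (b : kblock F) : pen F := Pen (blockA b) (blockB b).

Fixpoint diagA (F : fieldType) (s : seq (kblock F)) : 'M[F]_(diag_rows s, diag_cols s) :=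
  match s with
  | [::] => 0
  | b :: s' => block_mx (blockA b) 0 0 (diagA s')
  end.

Fixpoint diagB (F : fieldType) (s : seq (kblock F)) : 'M[F]_(diag_rows s, diag_cols s) :=
  match s with
  | [::] => 0
  | b :: s' => block_mx (blockB b) 0 0 (diagB s')
  end.

Definition pdiag (F : fieldType) (s : seq (kblock F)) : pen F := Pen (diagA s) (diagB s).

Lemma diag_pencilE (F : fieldType) (s : seq (kblock F)) :
  diag_pencil s = pencil (diagA s) (diagB s).
Proof.
rewrite /pencil; elim: s => [|b s IHs] /=; first by rewrite !map_mx0 scaler0 addr0.
rewrite IHs !map_block_mx !map_mx0 scale_block_mx add_block_mx !scaler0 !addr0.
congr block_mx.
case: b => [t|t|g mu|b] //=; rewrite /Lpencil /pencil.
by rewrite linearD linearZ /= !map_trmx.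
Qed.

Lemma pdiag_cat (F : fieldType) (s t : seq (kblock F)) :
  pdiag (s ++ t) ~= psum (pdiag s) (pdiag t).
Proof.
elim: s => [|b s IHs]; first by rewrite psum0l; reflexivity.
change (pdiag ((b :: s) ++ t)) with (psum (bpen b) (pdiag (s ++ t))).
by rewrite IHs psumA; reflexivity.
Qed.

(** On [L_t^T] and on nonempty [N_b] the image of the second matrix has codimension one; on [L_t]
    and [J] the second matrix is onto, so these blocks do not grow. *)
Definition bext (F : fieldType) (b : kblock F) : kblock F :=
  match b with
  | BlockLT t => BlockLT t.+1
  | BlockN b => BlockN b.+1
  | _ => b
  end.

Definition btr (F : fieldType) (b : kblock F) : kblock F :=
  match b with
  | BlockLT t => BlockL t
  | BlockL t => BlockLT t
  | _ => b
  end.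

(** An empty [N_0] is excluded because its second matrix is onto, so the reduction does not lengthen
    it to [N_1]. The degenerate [L_0] and [L_0^T] are genuine blocks. *)
Definition bpos (F : fieldType) (b : kblock F) : bool :=
  match b with
  | BlockJ g _ => 0 < g
  | BlockN b => 0 < b
  | _ => true
  end%N.

(** * Lengthening blocks *)

(** The last coordinate vector spans a complement of the image of [Z], and [Z^T] is a section of [Z]
    over that image: the data that [extends] asks for, with [c = 1]. *)
Lemma superdiag_last (F : fieldType) (b : nat) (c := b.+1)
  (Z := superdiag_mx F c c) (E : 'cV[F]_c := delta_mx ord_max 0) :
  [/\ Z *m Z^T + E *m E^T = 1%:M, E^T *m Z = 0 & E^T *m E = 1%:M].
Proof.
split.
- apply/matrixP => i j; rewrite !mxE big_ord1 !mxE eqxx !andbT.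
  case: (ltnP i b) => hi.
    have hi' : (i.+1 < b.+1)%N by [].
    rewrite (bigD1 (Ordinal hi')) //= !mxE /= eqxx mul1r big1 ?addr0.
      have -> : (i == ord_max) = false by apply/negbTE; rewrite -val_eqE /=; lia.
      by rewrite mul0r addr0 eqSS.
    by move=> k hk; rewrite !mxE -val_eqE /= in hk *; rewrite (negbTE hk) mul0r.
  have -> : i = ord_max by apply/val_inj => /=; have := ltn_ord i; lia.
  rewrite big1 ?add0r ?eqxx ?mul1r 1?eq_sym // => k _; rewrite !mxE /=.
  by have -> : (k == b.+1 :> nat) = false; [have := ltn_ord k; lia | rewrite mul0r].
- apply/matrixP => i j; rewrite !mxE big1 // => k _; rewrite !mxE.
  case: eqP => [->|]; last by rewrite mul0r.
  by have -> : (j == (@ord_max b).+1 :> nat) = false;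
    [have := ltn_ord j => /=; lia | rewrite mulr0].
by rewrite trmx_delta mul_delta_mx; apply/matrixP=> i j; rewrite !mxE !ord1.
Qed.

Lemma pid_last (F : fieldType) (t : nat) (Z : 'M[F]_(t.+1, t) := pid_mx t)
  (E : 'cV[F]_t.+1 := delta_mx ord_max 0) :
  [/\ Z *m Z^T + E *m E^T = 1%:M, E^T *m Z = 0 & E^T *m E = 1%:M].
Proof.
split.
- rewrite tr_pid_mx pid_mx_id //; apply/matrixP => i j.
  rewrite !mxE big_ord1 !mxE eqxx !andbT -!val_eqE /=.
  have hi := ltn_ord i; have hj := ltn_ord j.
  case: (ltnP i t) => ht.
    by rewrite andbT (_ : (i == t :> nat) = false) ?mul0r ?addr0 //; lia.
  have -> : i = t :> nat by lia.
  by rewrite andbF add0r eqxx mul1r eq_sym.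
- apply/matrixP => i j; rewrite !mxE big1 // => k _; rewrite !mxE.
  case: eqP => [->|]; last by rewrite mul0r.
  by rewrite ltnn andbF mulr0.
by rewrite trmx_delta mul_delta_mx; apply/matrixP=> i j; rewrite !mxE !ord1.
Qed.

Lemma pid_mulT (F : fieldType) (t : nat) :
  (pid_mx t : 'M[F]_(t, t.+1)) *m (pid_mx t)^T = 1%:M.
Proof. by rewrite tr_pid_mx pid_mx_id // pid_mx_1. Qed.

Lemma extends_N (F : fieldType) (b : nat) :
  (0 < b)%N -> extends (bpen (BlockN b : kblock F)) (bpen (BlockN b.+1)).
Proof.
case: b => // b _; have [h1 h2 h3] := superdiag_last F b.
exists 1%N, (delta_mx ord_max 0), (delta_mx ord_max 0)^T, (superdiag_mx F b.+1 b.+1)^T.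
split=> //; apply: peq_val => /=; rewrite ?addn1 // => i j i' j' ei ej.
  by rewrite -scalar_mx_block !mxE -!val_eqE /= ei ej.
have hj := ltn_ord j'; have hi := ltn_ord i'.
rewrite !mxE -ei -ej; case: (split_ordP i) ei => i1 -> /= ei; rewrite !mxE;
  case: (split_ordP j) ej => j1 -> /= ej; rewrite !mxE -?val_eqE /=;
  have hi1 := ltn_ord i1; have hj1 := ltn_ord j1 => //.
- by congr (nat_of_bool _)%:R; lia.
- by rewrite [X in nat_of_bool X](_ : _ = false) //; lia.
- by rewrite [X in nat_of_bool X](_ : _ = false) //; lia.
Qed.

Lemma extends_bpen (F : fieldType) (b : kblock F) :
  bpos b -> extends (bpen b) (bpen (bext b)).
Proof.
case: b => [t _|t _|g mu _|b]; last exact: extends_N.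
- have [h1 h2 h3] := pid_last F t.
  exists 1%N, (delta_mx ord_max 0), (delta_mx ord_max 0)^T, (pid_mx t).
  split=> //=; rewrite ?tr_pid_mx //; first by rewrite -h1 tr_pid_mx.
  apply: peq_val => /=; rewrite ?addn1 // => i j i' j' ei ej;
    have hj := ltn_ord j'; have hi := ltn_ord i';
    rewrite !mxE -ei -ej; case: (split_ordP i) ei => i1 -> /= ei; rewrite !mxE;
    case: (split_ordP j) ej => j1 -> /= ej; rewrite !mxE -?val_eqE /=;
    have hi1 := ltn_ord i1; have hj1 := ltn_ord j1 => //;
    first [congr (nat_of_bool _)%:R; lia
          | rewrite [X in nat_of_bool X](_ : _ = false) //; lia].
- exact: (@extends_refl F (bpen (BlockL t)) (pid_mx t)^T (pid_mulT F t)).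
by apply: (@extends_refl _ (bpen (BlockJ g mu)) 1%:M); rewrite mulmx1.
Qed.

(** [psh mu] turns [J_g^mu] into [N_g], which lengthens. For [nu != mu] the second matrix of the
    shifted block is triangular with [nu - mu] on the diagonal, hence onto. *)
Lemma extends_psh_J (F : fieldType) (g : nat) (nu mu : F) :
  (0 < g)%N -> extends (psh mu (bpen (BlockJ g nu)))
                 (psh mu (bpen (BlockJ (if nu == mu then g.+1 else g) nu))).
Proof.
move=> hg; case: eqP => [->|/eqP ne].
  have e m : psh mu (bpen (BlockJ m mu)) = bpen (BlockN m).
    by rewrite /psh /bpen /= scalemx1 addrC addKr.
  by rewrite !e; apply: extends_N.
have u : (nu%:M + superdiag_mx F g g - mu *: 1%:M) \in unitmx.
  (* [det_trig] concerns lower triangular matrices, hence the transposition. *)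
  rewrite unitmxE -det_tr det_trig.
    rewrite rpred_prod // => i _; rewrite !mxE eqxx /= (ltn_eqF (ltnSn _)).
    by rewrite addr0 mulr1 unitfE subr_eq0.
  apply/is_trig_mxP => i j ij; rewrite !mxE -!val_eqE /=.
  rewrite (gtn_eqF ij) (_ : (_ == _) = false); last by lia.
  by rewrite mulr0n mulr0 add0r subr0.
apply: (@extends_refl _ (psh mu (bpen (BlockJ g nu)))
  (invmx (nu%:M + superdiag_mx F g g - mu *: 1%:M))).
by rewrite /= mulmxV.
Qed.

(** Reversing the basis moves a transposed superdiagonal back above the diagonal, so blocks [J] and
    [N] are equivalent to their transposes. *)
Lemma peq_rev (F : fieldType) (n : nat) (A B : 'M[F]_n) :
  Pen A B ~= Pen (\matrix_(i, j) A (rev_ord i) (rev_ord j))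
                 (\matrix_(i, j) B (rev_ord i) (rev_ord j)).
Proof.
pose s : {perm 'I_n} := perm (@rev_ord_inj n).
have iS (u : {perm 'I_n}) : mxinv (perm_mx u : 'M[F]_n) (perm_mx u^-1%g).
  by split; rewrite -perm_mxM ?mulgV ?mulVg perm_mx1.
rewrite (peq_l _ _ (iS s)) (peq_r _ _ (iS s^-1%g)) -!row_permE -!col_permE.
apply: peq_val => // i j i' j' /val_inj -> /val_inj ->; rewrite !mxE ?permE //.
Qed.

Lemma ptr_bpen (F : fieldType) (b : kblock F) : ptr (bpen b) ~= bpen (btr b).
Proof.
case: b => [t|t|g mu|b]; rewrite /ptr /bpen /= ?trmxK; try reflexivity.
  rewrite peq_rev; apply: peq_val => // i j i' j' /val_inj -> /val_inj ->.
    rewrite !mxE -!val_eqE /=; have := ltn_ord i'; have := ltn_ord j' => h1 h2.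
    by congr (_ *+ (nat_of_bool _) + ((nat_of_bool _))%:R); lia.
  by rewrite !mxE (inj_eq rev_ord_inj) eq_sym.
rewrite peq_rev; apply: peq_val => // i j i' j' /val_inj -> /val_inj ->.
  by rewrite !mxE (inj_eq rev_ord_inj) eq_sym.
rewrite !mxE /=; have := ltn_ord i'; have := ltn_ord j' => h1 h2.
by congr ((nat_of_bool _))%:R; lia.
Qed.

Lemma ptr_pdiag (F : fieldType) (s : seq (kblock F)) :
  ptr (pdiag s) ~= pdiag [seq btr b | b <- s].
Proof.
elim: s => [|b s IHs] /=; first by rewrite /pdiag /ptr /= !trmx0; reflexivity.
change (pdiag (btr b :: [seq btr b | b <- s]))
  with (psum (bpen (btr b)) (pdiag [seq btr b | b <- s])).
change (pdiag (b :: s)) with (psum (bpen b) (pdiag s)).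
by rewrite ptr_psum IHs ptr_bpen; reflexivity.
Qed.

(** * Existence of the Kronecker form *)

Lemma peq_dims (F : fieldType) (p q : pen F) :
  p ~= q -> prows p = prows q /\ pcols p = pcols q.
Proof. by case=> S [S' [T [T' [/mxinv_dim e /mxinv_dim e' _ _]]]]. Qed.

Lemma peq_rankA (F : fieldType) (p q : pen F) :
  p ~= q -> \rank (penA p) = \rank (penA q).
Proof. by case=> S [S' [T [T' [iS iT <- _]]]]; rewrite (mxrank_inv _ iS iT). Qed.

Lemma unit_pencil (F : fieldType) (r n : nat) (A B : 'M[F]_(r, n)) :
  r = n -> \rank A = r -> exists N : 'M[F]_r, Pen A B ~= Pen 1%:M N.
Proof.
move=> e; case: n / e A B => A B rA.
have uA : A \in unitmx by rewrite -row_full_unit /row_full rA.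
exists (invmx A *m B).
have i : mxinv (invmx A) A by split; rewrite ?mulVmx ?mulmxV.
by rewrite (peq_l _ _ i) mulVmx //; reflexivity.
Qed.

Lemma psh_pdiag_cat (F : fieldType) (mu : F) (s t : seq (kblock F)) :
  psh mu (pdiag (s ++ t)) ~= psum (psh mu (pdiag s)) (psh mu (pdiag t)).
Proof. by rewrite pdiag_cat psh_psum; reflexivity. Qed.

(** * Jordan form over an algebraically closed field *)

Lemma eigenvalue_exists (F : closedFieldType) (n : nat) (M : 'M[F]_n) :
  (0 < n)%N -> exists mu : F, (\rank (M - mu *: 1%:M)%R < n)%N.
Proof.
move=> n0; have /closed_rootP [mu] : size (char_poly M) != 1%N.
  by rewrite size_char_poly eqSS -lt0n.
rewrite -eigenvalue_root_char => /eigenvalueP [v vM v0]; exists mu.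
rewrite ltn_neqAle rank_leq_row andbT; apply/negP => /row_freeP [X MX].
case/eqP: v0; rewrite -[v]mulmx1 -MX mulmxA mulmxBr vM -scalemxAr mulmx1.
by rewrite subrr mul0mx.
Qed.

Definition Jlist (F : fieldType) (js : seq (nat * F)) : seq (kblock F) :=
  [seq BlockJ j.1 j.2 | j <- js].

Lemma extends_psh_Jlist (F : fieldType) (mu : F) (js : seq (nat * F)) :
  all (fun j => 0 < j.1)%N js ->
  extends (psh mu (pdiag (Jlist js)))
   (psh mu (pdiag (Jlist [seq (if j.2 == mu then j.1.+1 else j.1, j.2) | j <- js]))).
Proof.
elim: js => [_|[g nu] js IHjs /= /andP [g0 /IHjs e]].
  by apply: (@extends_refl _ _ 0); apply/matrixP => -[].
rewrite -[pdiag (_ :: Jlist js)]/(psum (bpen (BlockJ g nu)) (pdiag (Jlist js))).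
set js' := map _ js in e *; set g' := if _ then _ else _.
rewrite -[pdiag (_ :: _)]/(psum (bpen (BlockJ g' nu)) (pdiag (Jlist js'))).
by rewrite !psh_psum; apply: extends_psum => //; apply: extends_psh_J.
Qed.

Lemma psum_scalar (F : fieldType) (a b : nat) :
  Pen (1%:M : 'M[F]_(a + b)) 0 = psum (Pen (1%:M : 'M_a) 0) (Pen (1%:M : 'M_b) 0).
Proof. by rewrite /psum /= -scalar_mx_block block_mx0. Qed.

Lemma superdiag1 (F : fieldType) : superdiag_mx F 1 1 = 0.
Proof. by apply/matrixP => i j; rewrite !mxE !ord1. Qed.

Lemma psh_nseq_J (F : fieldType) (mu : F) (a : nat) :
  psh mu (pdiag (nseq a (BlockJ 1 mu))) ~= Pen (1%:M : 'M_a) 0.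
Proof.
elim: a => [|a IHa].
  rewrite /pdiag /psh /= scaler0 subr0 (thinmx0 1%:M); reflexivity.
rewrite -[pdiag _]/(psum (bpen (BlockJ 1 mu)) (pdiag (nseq a (BlockJ 1 mu)))).
rewrite psh_psum IHa (psum_scalar F 1) /psh /= superdiag1 addr0 scalemx1 subrr.
reflexivity.
Qed.

(** Induction through the image of [M - mu], which is smaller for an eigenvalue [mu]. In the pencil
    [(1, M - mu)] exactly the blocks of eigenvalue [mu] are lengthened. *)
Lemma jordan_form (F : closedFieldType) (n : nat) (M : 'M[F]_n) :
  exists js : seq (nat * F),
    all (fun j => 0 < j.1)%N js /\ Pen M 1%:M ~= pdiag (Jlist js).
Proof.
elim/ltn_ind: n M => [[|n]] IH M.
  exists [::]; split=> //; apply: peq_val => // i; by case: (i).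
have [//|mu] := eigenvalue_exists M.
set B := M - mu *: 1%:M => rB.
have [n1 [s [z [A1 [B1 [B12 [R [hR eq]]]]]]]] := pencil_reduce 1%:M B.
have [/= d1 d2] := peq_dims eq; have /= := peq_rankA eq.
rewrite mxrank1 rank_diag_block_mx -addsmxE addsmx0 mxrank1 => d3.
(* Since the first matrix is invertible, counting dimensions forces [z = 0], [n1 = \rank B] and [A1]
   of full rank. *)
have d4 := rank_leq_row A1.
have [//||N eN] := @unit_pencil _ _ _ A1 B1; [lia|lia|].
(* Adding [mu] is undone by [psh mu], which takes [(N + mu, 1)] to [(1, N)]. *)
have [js [pjs ejs]] := IH _ rB (N + mu *: 1%:M).
have eN' : Pen A1 B1 ~= psh mu (pdiag (Jlist js)).
  by rewrite eN -ejs /psh /= addrK; reflexivity.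
have ext := extends_peq (peq_sym eN') (extends_psh_Jlist mu pjs).
have [a ea] := extends_reduced z hR ext.
set js' := map _ js in ea.
(* The [a] leftover summands [(1, 0)], read back through [psh mu], are Jordan blocks of size 1. *)
exists (js' ++ nseq a (1%N, mu)); split.
  rewrite all_cat all_nseq orbT andbT all_map; apply: sub_all pjs => j /= hj.
  by case: ifP.
apply: (@psh_inj _ mu); rewrite {1}/psh /= -/B eq ea.
have z0 : z = 0%N by lia.
rewrite z0 [Pen 0 0]/(pen0 F) psum0 /Jlist map_cat psh_pdiag_cat map_nseq psh_nseq_J.
reflexivity.
Qed.

Lemma extends_pdiag (F : fieldType) (s : seq (kblock F)) :
  all (@bpos F) s -> extends (pdiag s) (pdiag [seq bext b | b <- s]).
Proof.
elim: s => [_|b s IHs /= /andP [hb /IHs e]].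
  by apply: (@extends_refl _ _ 0); apply/matrixP => -[].
exact: (extends_psum (extends_bpen hb) e).
Qed.

Lemma nseq_N1 (F : fieldType) (a : nat) :
  pdiag (nseq a (BlockN 1 : kblock F)) ~= Pen (1%:M : 'M_a) 0.
Proof.
elim: a => [|a IHa].
  rewrite /pdiag /= (thinmx0 1%:M); reflexivity.
rewrite -[pdiag _]/(psum (bpen (BlockN 1)) (pdiag (nseq a (BlockN 1)))).
by rewrite IHa (psum_scalar F 1) /bpen /= superdiag1; reflexivity.
Qed.

Lemma nseq_LT0 (F : fieldType) (z : nat) :
  pdiag (nseq z (BlockLT 0 : kblock F)) ~= Pen (0 : 'M_(z, 0)) 0.
Proof.
elim: z => [|z IHz]; first reflexivity.
rewrite -[pdiag _]/(psum (bpen (BlockLT 0)) (pdiag (nseq z (BlockLT 0)))).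
rewrite IHz /psum /=; apply: peq_val => // i j; by case: (j).
Qed.

Definition has_kcf (F : fieldType) (p : pen F) : Prop :=
  exists s : seq (kblock F), all (@bpos F) s /\ p ~= pdiag s.

(** The restriction to the image of [penB p] has fewer rows and no more columns, so the hypothesis
    gives its blocks, which are then replaced by their [bext]. *)
Lemma has_kcf_reduce (F : fieldType) (p : pen F) :
  (\rank (penB p) < prows p)%N ->
  (forall q : pen F, (prows q + pcols q < prows p + pcols p)%N -> has_kcf q) ->
  has_kcf p.
Proof.
case: p => m n A B /= rB IH.
have [n1 [s [z [A1 [B1 [B12 [R [hR eq]]]]]]]] := pencil_reduce A B.
have [/= d1 d2] := peq_dims eq.
have [|t [pt et]] := IH (Pen A1 B1); first by rewrite /=; lia.
have [a ea] := extends_reduced z hR (extends_peq (peq_sym et) (extends_pdiag pt)).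
exists (map (@bext F) t ++ nseq a (BlockN 1) ++ nseq z (BlockLT 0)); split.
  rewrite !all_cat !all_nseq !orbT !andbT all_map; apply: sub_all pt.
  by case.
rewrite eq ea !pdiag_cat nseq_N1 nseq_LT0 psumA; reflexivity.
Qed.

Lemma kronecker_form (F : closedFieldType) (p : pen F) : has_kcf p.
Proof.
(* The measure is symmetric in rows and columns, hence stable under transposition. *)
move: {2}(_ + _)%N (leqnn (prows p + pcols p)) => k.
elim/ltn_ind: k p => k IH p hp.
have {}IH (q : pen F) : (prows q + pcols q < prows p + pcols p)%N -> has_kcf q.
  by move=> hq; apply: (IH (prows q + pcols q)%N) => //; lia.
case: (ltnP (\rank (penB p)) (prows p)) => hr; first exact: has_kcf_reduce.
case: (ltnP (\rank (penB p)) (pcols p)) => hc.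
  have [||s [ps es]] := @has_kcf_reduce _ (ptr p).
  - by rewrite /= mxrank_tr.
  - by move=> q /= hq; apply: IH; lia.
  exists [seq btr b | b <- s]; split.
    by rewrite all_map; apply: sub_all ps; case.
  by rewrite -[p]ptrK es ptr_pdiag; reflexivity.
case: p hr hc {IH hp} => m n A B /= hr hc.
have rm := rank_leq_row B; have rn := rank_leq_col B.
have e : m = n by lia.
case: n / e A B hr hc rm rn => A B hr hc rm rn.
have uB : B \in unitmx by rewrite -row_full_unit /row_full eqn_leq rm.
have [js [pjs ejs]] := jordan_form (invmx B *m A).
exists (Jlist js); split; first by rewrite all_map; apply: sub_all pjs => j.
have i : mxinv (invmx B) B by split; rewrite ?mulVmx ?mulmxV.
by rewrite (peq_l _ _ i) mulVmx // ejs; reflexivity.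
Qed.

(** * Singular chains and the indices of commuting matrices *)

(** The index is a natural number, not an ordinal: the column is zero for [e <= j], which ends a
    chain without a separate case. *)
Definition unit_col (F : fieldType) (e j : nat) : 'cV[F]_e :=
  \col_(k < e) (k == j :> nat)%:R.

Lemma mul_unit_col (F : fieldType) (m e : nat) (Q : 'M[F]_(m, e)) (j : 'I_e) :
  Q *m unit_col F e j = col j Q.
Proof.
apply/matrixP => i k; rewrite !mxE (bigD1 j) //= !mxE eqxx mulr1 big1 ?addr0 //.
by move=> l lj; rewrite !mxE (inj_eq val_inj) (negbTE lj) mulr0.
Qed.

Lemma unit_col_ge (F : fieldType) (e j : nat) : (e <= j)%N -> unit_col F e j = 0.
Proof.
move=> ej; apply/matrixP => i k; rewrite !mxE.
by rewrite ltn_eqF //; apply: leq_trans ej.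
Qed.

Lemma pid_unit_col (F : fieldType) (e j : nat) :
  (pid_mx e : 'M[F]_(e, e.+1)) *m unit_col F e.+1 j = unit_col F e j.
Proof.
case: (ltnP j e) => je; last first.
  rewrite (unit_col_ge _ je); apply/matrixP => i k; rewrite !mxE big1 // => l _.
  rewrite !mxE; case: eqP => [<-|_]; last by rewrite mul0r.
  by rewrite ltn_eqF ?mulr0 //; apply: leq_trans je.
rewrite (@mul_unit_col _ _ _ _ (Ordinal (leqW je))).
by apply/matrixP => i k; rewrite !mxE /= ltn_ord andbT.
Qed.

Lemma superdiag_unit_col (F : fieldType) (e j : nat) :
  superdiag_mx F e e.+1 *m unit_col F e.+1 j.+1 = unit_col F e j.
Proof.
apply/matrixP => i k; rewrite !mxE (bigD1 (lift ord0 i)) //= !mxE /= eqxx mul1r eqSS.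
rewrite big1 ?addr0 // => l; rewrite !mxE -val_eqE /= => /negbTE.
by rewrite /bump /= add1n => ->; rewrite mul0r.
Qed.

Lemma superdiag_unit_col0 (F : fieldType) (e : nat) :
  superdiag_mx F e e.+1 *m unit_col F e.+1 0 = 0.
Proof.
apply/matrixP => i k; rewrite !mxE big1 // => l _; rewrite !mxE.
by case: eqP => [->|_]; rewrite ?mulr0 ?mul0r.
Qed.

Lemma superdiag_mulT (F : fieldType) (t : nat) :
  superdiag_mx F t t.+1 *m (superdiag_mx F t t.+1)^T = 1%:M.
Proof.
apply/matrixP => i j; rewrite !mxE (bigD1 (lift ord0 i)) //= !mxE /= eqxx mul1r eqSS.
rewrite big1 ?addr0 // => l; rewrite !mxE -val_eqE /= => /negbTE.
by rewrite /bump /= add1n => ->; rewrite mul0r.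
Qed.

(* A solution [Q] of [A' Q [I 0] = B' Q [0 I]] is a singular chain of [A' + x B']. *)
Lemma singular_chain (F : fieldType) (r c e : nat) (A' B' : 'M[F]_(r, c))
  (Q : 'M[F]_(c, e)) :
  A' *m Q *m pid_mx e = B' *m Q *m superdiag_mx F e e.+1 ->
  exists q : nat -> 'cV[F]_c,
  [/\ A' *m q 0%N = 0, forall j, A' *m q j.+1 = B' *m q j,
      forall j, (e <= j)%N -> q j = 0 & (forall j, q j = 0) -> Q = 0].
Proof.
(* The matrix equation is evaluated on each coordinate vector of the space of dimension [e + 1]. *)
move=> eq; have h j := congr1 (mulmx^~ (unit_col F e.+1 j)) eq.
exists (fun j => Q *m unit_col F e j); split.
- by have := h 0%N; rewrite /= -!mulmxA pid_unit_col superdiag_unit_col0 !mulmx0.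
- by move=> j; have := h j.+1; rewrite /= -!mulmxA pid_unit_col superdiag_unit_col.
- by move=> j /unit_col_ge ->; rewrite mulmx0.
move=> q0; apply/matrixP => i j; have := q0 j.
by rewrite mul_unit_col => /matrixP /(_ i 0); rewrite !mxE.
Qed.

Lemma superdiag_mulE (F : fieldType) (t : nat) (v : 'cV[F]_t.+1) (k : 'I_t) :
  (superdiag_mx F t t.+1 *m v) k 0 = v (inord k.+1) 0.
Proof.
have hk : (k.+1 < t.+1)%N by rewrite ltnS ltn_ord.
rewrite !mxE (bigD1 (inord k.+1)) //= !mxE inordK // eqxx mul1r.
rewrite big1 ?addr0 // => l; rewrite !mxE -val_eqE /= inordK // => /negbTE ->.
by rewrite mul0r.
Qed.

Lemma pid_mulE (F : fieldType) (t : nat) (v : 'cV[F]_t.+1) (k : 'I_t) :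
  ((pid_mx t : 'M[F]_(t, t.+1)) *m v) k 0 = v (inord k) 0.
Proof.
have hk : (k < t.+1)%N by apply: ltnW; rewrite ltnS ltn_ord.
rewrite !mxE (bigD1 (inord k)) //= !mxE inordK // eqxx ltn_ord mul1r.
rewrite big1 ?addr0 // => l; rewrite !mxE -val_eqE /= inordK // eq_sym => /negbTE ->.
by rewrite mul0r.
Qed.

(** If [blockA b] is injective the chain vanishes from its first term upwards, as for [L^T] and [N];
    if [blockB b] is injective it vanishes from its last term downwards, as for [J]. Neither holds
    for [L_t], where entries are followed along diagonals. *)
Lemma block_chain_vanish (F : fieldType) (b : kblock F) (e : nat)
  (Q : 'M[F]_(block_cols b, e)) :
  blockA b *m Q *m pid_mx e = blockB b *m Q *m superdiag_mx F e e.+1 ->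
  (forall e', b = BlockL e' -> e <= e')%N -> Q = 0.
Proof.
move=> /singular_chain [q [q0 qS qe Q0]] hb; apply: Q0.
have injA X : X *m blockA b = 1%:M -> forall j, q j = 0.
  move=> XA; elim=> [|j IHj]; first by rewrite -[q 0%N]mul1mx -XA -mulmxA q0 mulmx0.
  by rewrite -[q _]mul1mx -XA -mulmxA qS IHj !mulmx0.
have injB X : X *m blockB b = 1%:M -> forall j, q j = 0.
  move=> XB j; have [k] := ubnP (e - j)%N; elim: k j => // k IHk j hj.
  case: (leqP e j) => ej; first exact: qe.
  by rewrite -[q j]mul1mx -XB -mulmxA -qS IHk ?mulmx0 //; lia.
case: b Q q q0 qS qe hb injA injB => [t|t|g mu|b] Q q q0 qS qe hb injA injB.
- exact: (injA _ (superdiag_mulT F t)).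
- have {}hb := hb t erefl.
  pose u j i := q j (inord i) 0.
  have u0 k : (k < t)%N -> u 0%N k.+1 = 0.
    by move=> kt; have /matrixP /(_ (Ordinal kt) 0) := q0; rewrite superdiag_mulE !mxE.
  have uS j k : (k < t)%N -> u j.+1 k.+1 = u j k.
    move=> kt; have /matrixP /(_ (Ordinal kt) 0) := qS j.
    by rewrite superdiag_mulE pid_mulE.
  (* [u] is constant along diagonals. For [j < i] the diagonal goes back to the row [j = 0], where
     the entry is zero. Otherwise it goes forward to [i = t], where the chain index is at least [t],
     so at least [e], and the chain has ended. *)
  have uz j i : (i <= t)%N -> u j i = 0.
    move=> it; case: (ltnP j i) => ji.
      elim: j i it ji => [|j IHj] [|i] // it ji; first exact: u0.
      by rewrite uS // IHj // ltnW.
    have [m] := ubnP (t - i)%N; elim: m i j it ji => // m IHm i j it ji hm.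
    case: (ltnP i t) => ti; last by rewrite /u qe ?mxE //; lia.
    by rewrite -uS // IHm //; lia.
  move=> j; apply/matrixP => i k; rewrite (ord1 k) mxE -(inord_val i).
  by apply: uz; rewrite -ltnS.
- by apply: (injB 1%:M); rewrite mul1mx.
by apply: (injA 1%:M); rewrite mul1mx.
Qed.

(* [Lrows f s] and [Lcols f s] are the coordinate projections on the rows and the
   columns of the blocks [BlockL e] with [f e]. *)
Definition isL (F : Type) (f : pred nat) (b : kblock F) : bool :=
  if b is BlockL e then f e else false.

Fixpoint Lrows (F : fieldType) (f : pred nat) (s : seq (kblock F)) :
    'M[F]_(diag_rows s) :=
  match s with
  | [::] => 0
  | b :: s' => block_mx (isL f b)%:R%:M 0 0 (Lrows f s')
  end.

Fixpoint Lcols (F : fieldType) (f : pred nat) (s : seq (kblock F)) :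
    'M[F]_(diag_cols s) :=
  match s with
  | [::] => 0
  | b :: s' => block_mx (isL f b)%:R%:M 0 0 (Lcols f s')
  end.

Definition Lidx (F : Type) (s : seq (kblock F)) : seq nat :=
  pmap (fun b => if b is BlockL e then Some e else None) s.

Lemma rank_boolM (F : fieldType) (n : nat) (c : bool) :
  \rank ((c%:R)%:M : 'M[F]_n) = (c * n)%N.
Proof. by case: c; rewrite ?mxrank1 ?mul1n // raddf0 ?mxrank0. Qed.

Lemma rank_Lrows (F : fieldType) (f : pred nat) (s : seq (kblock F)) :
  \rank (Lrows f s) = (\sum_(e <- Lidx s | f e) e)%N.
Proof.
elim: s => [|b s IHs] /=; first by rewrite mxrank0 big_nil.
rewrite rank_diag_block_mx rank_boolM IHs /Lidx /=.
by case: b => [t|t|g mu|b] //=; rewrite big_cons; case: (f t); rewrite ?mul1n.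
Qed.

Lemma rank_Lcols (F : fieldType) (f : pred nat) (s : seq (kblock F)) :
  \rank (Lcols f s) = (\sum_(e <- Lidx s | f e) e.+1)%N.
Proof.
elim: s => [|b s IHs] /=; first by rewrite mxrank0 big_nil.
rewrite rank_diag_block_mx rank_boolM IHs /Lidx /=.
by case: b => [t|t|g mu|b] //=; rewrite big_cons; case: (f t); rewrite ?mul1n.
Qed.

(** The equation splits over the blocks [b'] of [s']. If [b] is [L_e] with [e <= d], the slice of
    [Q] over [b'] vanishes unless [b'] is some [L_e'] with [e' < e], and such a block is kept by the
    projection. *)
Lemma Lcols_absorb1 (F : fieldType) (d : nat) (b : kblock F) (s' : seq (kblock F))
  (Q : 'M[F]_(diag_cols s', block_rows b)) :
  diagA s' *m Q *m blockB b = diagB s' *m Q *m blockA b ->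
  isL (leq^~ d) b -> Lcols (ltn^~ d) s' *m Q = Q.
Proof.
move=> + hb; elim: s' Q => [|b' s' IHs] Q /=; first by move=> _; apply/matrixP => -[].
rewrite -[Q]vsubmxK !mul_block_col !mul0mx !addr0 !add0r !mul_col_mx.
case/eq_col_mx => e1 /IHs ->; congr col_mx.
case: (boolP (isL _ b')) => hb'; first by rewrite mul1mx.
rewrite /= raddf0 mul0mx; apply: esym.
case: b hb Q e1 {IHs} => // e /= ed Q e1; apply: (block_chain_vanish e1) => e' eb'.
move: hb'; rewrite eb' /= -leqNgt; exact: leq_trans.
Qed.

Lemma Lcols_absorb (F : fieldType) (d : nat) (s s' : seq (kblock F))
  (Q : 'M[F]_(diag_cols s', diag_rows s)) :
  diagA s' *m Q *m diagB s = diagB s' *m Q *m diagA s ->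
  Lcols (ltn^~ d) s' *m Q *m Lrows (leq^~ d) s = Q *m Lrows (leq^~ d) s.
Proof.
elim: s Q => [|b s IHs] Q /=; first by rewrite !mulmx0.
rewrite -[Q]hsubmxK !mul_mx_row !mul_row_block !mulmx0 !addr0 !add0r.
case/eq_row_mx => e1 /IHs ->; congr row_mx.
case: (boolP (isL _ b)) => hb; last by rewrite /= raddf0 !mulmx0.
by rewrite !mulmx1 (Lcols_absorb1 e1 hb).
Qed.

Lemma comm_L_indices (F : fieldType) (n : nat) (A B : 'M[F]_n)
  (s : seq (kblock F)) (d : nat) :
  comm_mx A B -> Pen A B ~= pdiag s ->
  (\sum_(e <- Lidx s | e <= d) e <= \sum_(e <- Lidx s | e < d) e.+1)%N.
Proof.
move=> AB [S [S' [T [T' [iS iT /= eA eB]]]]].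
have [SS S'S] := iS; have [TT T'T] := iT.
(* With [P = T' S'], both sides are [S A B T], by commutation. *)
have ePP : diagA s *m (T' *m S') *m diagB s = diagB s *m (T' *m S') *m diagA s.
  rewrite -eA -eB.
  have h (X Y : 'M[F]_n) :
      S *m X *m T *m (T' *m S') *m (S *m Y *m T) = S *m (X *m Y) *m T.
    by rewrite -!mulmxA (mulmxA T) TT mul1mx (mulmxA S') S'S mul1mx.
  by rewrite !h AB.
rewrite -rank_Lcols -rank_Lrows.
(* Multiplication by the invertible [P] keeps the rank of [Lrows], while [P *m Lrows] factors
   through [Lcols]. *)
rewrite -(mxrank_inv (Lrows _ s) (mxinv_mul (mxinv_sym iT) (mxinv_sym iS)) (mxinv1 F _)).
by rewrite mulmx1 -(Lcols_absorb d ePP) -mulmxA mxrankM_maxl.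
Qed.

(** * Collecting equal blocks *)

Lemma pdiag_move (F : fieldType) (b : kblock F) (s t : seq (kblock F)) :
  pdiag (s ++ b :: t) ~= pdiag (b :: s ++ t).
Proof.
rewrite pdiag_cat -[pdiag (b :: t)]/(psum (bpen b) (pdiag t)).
rewrite -[pdiag (b :: s ++ t)]/(psum (bpen b) (pdiag (s ++ t))).
by rewrite pdiag_cat !psumA (psumC (pdiag s)); reflexivity.
Qed.

Lemma pdiag_perm (F : fieldType) (G : nat -> kblock F) (u v : seq nat) :
  perm_eq u v -> pdiag [seq G x | x <- u] ~= pdiag [seq G x | x <- v].
Proof.
move=> uv; apply: (catCA_perm_ind
  (P := fun w => pdiag [seq G x | x <- u] ~= pdiag [seq G x | x <- w])) uv _;
  last reflexivity.
move=> s1 s2 s3 ->; rewrite !map_cat !pdiag_cat !psumA.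
by rewrite (psumC (pdiag (map G s1))); reflexivity.
Qed.

(** The indices of the [L^T] blocks are read as the [L] indices of the transposed list, the form in
    which [comm_L_indices] for the transposed pair bounds them. *)
Lemma pdiag_sort (F : fieldType) (s : seq (kblock F)) :
  all (@bpos F) s ->
  exists (js : seq (nat * F)) (ns : seq nat),
  [/\ all (fun j => 0 < j.1)%N js, all (fun x => 0 < x)%N ns &
      pdiag s ~= pdiag ([seq BlockLT x | x <- Lidx [seq btr b | b <- s]]
                     ++ [seq BlockL x | x <- Lidx s]
                     ++ Jlist js ++ [seq BlockN x | x <- ns])].
Proof.
elim: s => [_|b s IHs /= /andP [hb /IHs [js [ns [pj pn e]]]]].
  by exists [::], [::]; split=> //; reflexivity.
rewrite -[pdiag (b :: s)]/(psum (bpen b) (pdiag s)) /Lidx /=.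
case: b hb => [t _|t _|g mu g0|x x0] /=.
- exists js, ns; split=> //; rewrite e; reflexivity.
- exists js, ns; split=> //; rewrite pdiag_move e; reflexivity.
- exists ((g, mu) :: js), ns; split=> //=; first exact/andP.
  rewrite catA pdiag_move -catA e; reflexivity.
exists js, (x :: ns); split=> //=; first exact/andP.
rewrite 2!catA pdiag_move -!catA e; reflexivity.
Qed.

Lemma perm_flatten_count (T : eqType) (u w : seq T) :
  uniq w -> {subset u <= w} ->
  perm_eq u (flatten [seq nseq (count_mem x u) x | x <- w]).
Proof.
move=> uw sub; apply/allP => y _ /=; apply/eqP.
rewrite count_flatten -map_comp sumnE big_map.
case: (boolP (y \in w)) => yw.
  rewrite (bigD1_seq y) //= count_nseq /= eqxx mul1n big1 ?addn0 // => x xy.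
  by rewrite count_nseq /= (negbTE xy).
rewrite big_seq big1 => [|x xw].
  by apply/count_memPn; apply: contra yw; apply: sub.
rewrite /= count_nseq /=; case: eqP => // xy; by rewrite -xy xw in yw.
Qed.

Lemma count_le_sum (T : eqType) (a : pred T) (u t : seq T) :
  {in u, forall x, a x -> x \in t} ->
  (count a u <= \sum_(x <- t) count_mem x u)%N.
Proof.
elim: u => // y u IHu h /=; rewrite big_split /=; apply: leq_add; last first.
  by apply: IHu => x xu; apply: h; rewrite inE xu orbT.
case ay: (a y) => //; have yt := h y (mem_head _ _) ay.
by rewrite (big_rem y) //= eqxx.
Qed.

Lemma map_nth_iota1 (T U : Type) (f : T -> U) (x0 : T) (s : seq T) :
  [seq f (nth x0 s i.-1) | i <- iota 1 (size s)] = map f s.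
Proof.
by rewrite -add1n iotaDl -map_comp -[in RHS](mkseq_nth x0 s) /mkseq -map_comp.
Qed.

Lemma sum_leq_split (u : seq nat) (d : nat) :
  (\sum_(e <- u | e <= d) e = d * count_mem d u + \sum_(e <- u | e < d) e)%N.
Proof.
elim: u => [|e u IHu]; rewrite ?big_nil ?muln0 // !big_cons /= IHu mulnDr.
by case: ltngtP => [||->]; rewrite /= ?muln0 ?muln1; lia.
Qed.

Lemma sum_succ_split (u : seq nat) (a : pred nat) :
  (\sum_(e <- u | a e) e.+1 = count a u + \sum_(e <- u | a e) e)%N.
Proof. by rewrite -sum1_count -big_split. Qed.

(* The hypothesis at [d = delta i] reduces to the last conclusion after cancelling
   the sum of the indices below [d]. *)
Lemma group_indices (u : seq nat) :
  (forall d, \sum_(e <- u | e <= d) e <= \sum_(e <- u | e < d) e.+1)%N ->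
  exists (k : nat) (nn delta : nat -> nat),
  [/\ perm_eq u (nseq (nn 0) 0 ++ flatten [seq nseq (nn i) (delta i) | i <- iota 1 k]),
      forall i, 1 <= i <= k -> 0 < delta i /\ 0 < nn i,
      forall i j, 1 <= i -> i < j -> j <= k -> delta i < delta j &
      forall i, 1 <= i <= k -> delta i * nn i <= \sum_(0 <= j < i) nn j]%N.
Proof.
(* [w] lists the distinct values in increasing order, with 0 always in front: position 0 is reserved
   for the degenerate blocks even if their multiplicity is zero. *)
move=> hu; pose v := sort leq (undup [seq x <- u | 0 < x]%N); pose w := 0%N :: v.
have mv x : (x \in v) = (0 < x)%N && (x \in u).
  by rewrite mem_sort mem_undup mem_filter.
have sw : sorted ltn w.
  rewrite /= path_min_sorted; last by apply/allP => x; rewrite mv => /andP [].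
  by rewrite ltn_sorted_uniq_leq sort_uniq undup_uniq sort_sorted //; apply: leq_total.
have uw : uniq w by apply: (sorted_uniq ltn_trans ltnn).
have sub : {subset u <= w}.
  by move=> x xu; rewrite inE mv xu andbT lt0n; case: eqP.
have mono i j : (i < j)%N -> (j <= size v)%N -> (nth 0 w i < nth 0 w j)%N.
  by move=> ij jk; apply: (sorted_ltn_nth ltn_trans 0%N sw) => //; rewrite ?inE /=; lia.
exists (size v), (fun i => count_mem (nth 0 w i) u), (nth 0%N w); split.
- have := perm_flatten_count uw sub.
  rewrite /= -(map_nth_iota1 (fun x => nseq (count_mem x u) x) 0%N).
  congr (perm_eq u (_ ++ flatten _)); apply/eq_in_map => -[|i] //.
  by rewrite mem_iota.
- move=> [//|i] /= ik; have : nth 0%N v i \in v by apply: mem_nth.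
  by rewrite mv => /andP [-> h]; rewrite -has_count has_pred1.
- by move=> i j _; apply: mono.
move=> i ik; set d := nth 0%N w i; have := hu d.
rewrite sum_leq_split sum_succ_split leq_add2r => /leq_trans; apply.
(* As [w] is increasing, a value below [d], its entry at position [i], occurs among its first [i]
   entries. *)
have : (count (ltn^~ d) u <= \sum_(x <- take i w) count_mem x u)%N.
  apply: count_le_sum => x xu xd; rewrite in_take ?sub // ltnNge; apply/negP => hi.
  have xw := sub x xu; move: hi; rewrite leq_eqVlt => /orP [/eqP ix | ix].
    by move: xd; rewrite /= /d ix nth_index // ltnn.
  have := mono _ _ ix; rewrite nth_index // -ltnS -[(size v).+1]/(size w) index_mem.
  by move=> /(_ xw) /ltn_trans /(_ xd); rewrite ltnn.
have iw : (i <= size w)%N by case/andP: ik => _ h; apply: ltnW.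
rewrite (big_nth 0%N) size_takel // => /leq_trans; apply; apply: eq_leq.
by apply: eq_big_nat => j /andP [_ ji]; rewrite nth_take.
Qed.

(** * Assembling the normal form *)

Lemma kronecker_blocksE (F : fieldType) (k : nat) (nn delta : nat -> nat) (l : nat)
  (mm eps : nat -> nat) (js : seq (nat * F)) (ns : seq nat) :
  kronecker_blocks k nn delta l mm eps
    (size js) (fun i => (nth (1%N, 0) js i.-1).1) (fun i => (nth (1%N, 0) js i.-1).2)
    (size ns) (fun i => nth 1%N ns i.-1)
  = [seq BlockLT x | x <- nseq (nn 0%N) 0%N
                       ++ flatten [seq nseq (nn i) (delta i) | i <- iota 1 k]]
    ++ [seq BlockL x | x <- nseq (mm 0%N) 0%N
                       ++ flatten [seq nseq (mm i) (eps i) | i <- iota 1 l]]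
    ++ Jlist js ++ [seq BlockN x | x <- ns].
Proof.
rewrite /kronecker_blocks (map_nth_iota1 (fun x => BlockN x)).
rewrite (map_nth_iota1 (fun j => BlockJ j.1 j.2)) !map_cat !map_flatten -!map_comp.
rewrite !map_nseq -!catA; congr (_ ++ flatten _ ++ _ ++ flatten _ ++ _).
  by apply: eq_map => i /=; rewrite map_nseq.
by apply: eq_map => i /=; rewrite map_nseq.
Qed.

(** The equivalence itself forces [r = c = n]; eliminating these equalities gives the cast and makes
    [S] and [T] square, so that a one-sided inverse proves them invertible. *)
Lemma pencil_equiv_cast (F : fieldType) (n r c : nat) (A B : 'M[F]_n)
  (A' B' : 'M[F]_(r, c)) :
  Pen A B ~= Pen A' B' ->
  exists (S T : 'M[F]_n) (Hr : r = n) (Hc : c = n),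
    (S \in unitmx /\ T \in unitmx) /\
    map_mx polyC S *m pencil A B *m map_mx polyC T = castmx (Hr, Hc) (pencil A' B').
Proof.
move=> e; have [/= e1 e2] := peq_dims e; case: r / e1 A' B' e => A' B' e.
case: c / e2 A' B' e => A' B' [S [S' [T [T' [[SS _] [TT _] /= <- <-]]]]].
exists S, T, erefl, erefl; rewrite castmx_id; split.
  by split; [case/mulmx1_unit: SS | case/mulmx1_unit: TT].
rewrite /pencil !map_mxM mulmxDr mulmxDl -!scalemxAr -!scalemxAl.
by [].
Qed.

Theorem theorem5p1 (R : realType) (n : nat) (A B : 'M[R[i]]_n)
    (hAB : comm_mx A B) :
  exists S T : 'M[R[i]]_n,
  exists (k : nat) (nn delta : nat -> nat) (l : nat) (mm eps : nat -> nat),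
  exists (p : nat) (gamma : nat -> nat) (lam : nat -> R[i]),
  exists (q : nat) (beta : nat -> nat),
  let D := kronecker_blocks k nn delta l mm eps p gamma lam q beta in
  exists (Hr : diag_rows D = n) (Hc : diag_cols D = n),
    (S \in unitmx /\ T \in unitmx) /\
    map_mx polyC S *m pencil A B *m map_mx polyC T
      = castmx (Hr, Hc) (diag_pencil D) /\
    (forall i : nat, (1 <= i <= k)%N -> (0 < delta i)%N /\ (0 < nn i)%N) /\
    (forall i j : nat, (1 <= i)%N -> (i < j)%N -> (j <= k)%N ->
       (delta i < delta j)%N) /\
    (forall i : nat, (1 <= i <= l)%N -> (0 < eps i)%N /\ (0 < mm i)%N) /\
    (forall i j : nat, (1 <= i)%N -> (i < j)%N -> (j <= l)%N ->
       (eps i < eps j)%N) /\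
    (forall i : nat, (1 <= i <= p)%N -> (0 < gamma i)%N) /\
    (forall i : nat, (1 <= i <= q)%N -> (0 < beta i)%N) /\
    (forall i : nat, (1 <= i <= k)%N ->
       (delta i * nn i <= \sum_(0 <= j < i) nn j)%N) /\
    (forall i : nat, (1 <= i <= l)%N ->
       (eps i * mm i <= \sum_(0 <= j < i) mm j)%N).
Proof.
have [s [ps es]] := kronecker_form (Pen A B).
have tAB : comm_mx A^T B^T by rewrite /comm_mx -!trmx_mul hAB.
have ets : Pen A^T B^T ~= pdiag [seq btr b | b <- s].
  by rewrite -[Pen _ _]/(ptr (Pen A B)) es ptr_pdiag; reflexivity.
have [l [mm [eps [pm hm1 hm2 hm3]]]] :=
  group_indices (fun d => comm_L_indices d hAB es).
have [k [nn [delta [pn hn1 hn2 hn3]]]] :=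
  group_indices (fun d => comm_L_indices d tAB ets).
have [js [ns [pjs pns eD]]] := pdiag_sort ps.
(* The families start at index 1 and lists at 0, hence [i.-1]; on the ranges concerned the positions
   lie inside the lists, so the defaults do not occur. *)
pose gamma i := (nth (1%N, 0 : R[i]) js i.-1).1.
pose lam i := (nth (1%N, 0 : R[i]) js i.-1).2.
pose beta i := nth 1%N ns i.-1.
have {es eD} : Pen A B ~= pdiag (kronecker_blocks k nn delta l mm eps
                                  (size js) gamma lam (size ns) beta).
  rewrite es eD kronecker_blocksE !pdiag_cat.
  by rewrite (pdiag_perm (@BlockLT _) pn) (pdiag_perm (@BlockL _) pm); reflexivity.
case/pencil_equiv_cast => S [T [Hr [Hc [uST eST]]]].
exists S, T, k, nn, delta, l, mm, eps, (size js), gamma, lam, (size ns), beta => D.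
exists Hr, Hc; split; first exact: uST.
split; first by rewrite diag_pencilE.
do 4![split=> //]; split.
  by case=> // i /= hi; have /allP := pjs; apply; exact: mem_nth.
split=> //.
by case=> // i /= hi; have /allP := pns; apply; exact: mem_nth.
Qed.
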